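(* Let $R$ be a commutative Noetherian local ring and let $M \neq (0)$ be a finitely generated $R$-module. Let $R \ltimes M$ denote the idealization of $M$ over $R$. Then the following conditions are equivalent. (1) $R \ltimes M$ is a sequentially Cohen-Macaulay local ring. (2) $R \ltimes M$ is a sequentially Cohen-Macaulay $R$-module. (3) $R$ is a sequentially Cohen-Macaulay local ring and $M$ is a sequentially Cohen-Macaulay $R$-module.
   Context: The idealization (trivial extension) $R \ltimes M$ is the ring with underlying additive group $R \oplus M$ and multiplication $(a,x)(b,y) = (ab, ay + bx)$; it is an $R$-algebra via $a \mapsto (a,0)$. Let $L \neq (0)$ be a finitely generated module of finite dimension over a Noetherian ring $S$. For each $n \in \mathbb{Z}$ there is a largest $S$-submodule $L_n$ of $L$ with $\dim_S L_n \le n$ (convention: $\dim_S (0) = -\infty$). Put $\mathcal{S}(L) = \{\dim_S N \mid N \text{ is an } S\text{-submodule of } L,\ N \neq (0)\} = \{\dim S/\mathfrak{p} \mid \mathfrak{p} \in \mathrm{Ass}_S L\}$, a finite set, and write $\mathcal{S}(L) = \{d_1 < \cdots < d_\ell = \dim_S L\}$. The dimension filtration of $L$ is the chain $D_0 = (0) \subsetneq D_1 \subsetneq \cdots \subsetneq D_\ell = L$ with $D_i = L_{d_i}$ for $1 \le i \le \ell$. $L$ is called a sequentially Cohen-Macaulay $S$-module if $D_i/D_{i-1}$ is a Cohen-Macaulay $S$-module for every $1 \le i \le \ell$. The ring $S$ is a sequentially Cohen-Macaulay ring if $\dim S < \infty$ and $S$ is a sequentially Cohen-Macaulay module over itself.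 *)

(* Defs.v *)
From HB Require Import structures.
From mathcomp Require Import all_boot all_order all_algebra.
From mathcomp Require Import ring_quotient generic_quotient.

Set Implicit Arguments.
Unset Strict Implicit.
Unset Printing Implicit Defensive.

Import GRing.Theory.
Local Open Scope ring_scope.

(* Ideals, primes and submodules are boolean predicates, as in the algebra
   library.  Under classical logic with choice these are all the subsets, so no
   decidability restriction is intended.  Note that idealr, idealr_closed and
   prime_idealr only allow proper ideals. *)

Section Idealization.
Variables (R : comNzRingType) (M : lmodType R).

Definition idealization : Type := (R * M)%type.

HB.instance Definition _ := GRing.Zmodule.on idealization.

Implicit Types u v w : idealization.

Definition trivext_one : idealization := (1, 0).
Definition trivext_mul u v : idealization :=
  (u.1 * v.1, u.1 *: v.2 + v.1 *: u.2).

Fact trivext_mulA : associative trivext_mul.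
Proof.
move=> u v w; congr pair => /=; first by rewrite mulrA.
by rewrite !scalerDr !scalerA addrA (mulrC w.1 u.1) (mulrC w.1 v.1).
Qed.

Fact trivext_mulC : commutative trivext_mul.
Proof. by move=> u v; congr pair => /=; rewrite (mulrC, addrC). Qed.

Fact trivext_mul1 : left_id trivext_one trivext_mul.
Proof.
by case=> a x; congr pair => /=; rewrite ?mul1r // scale1r scaler0 addr0.
Qed.

Fact trivext_mulDl : left_distributive trivext_mul +%R.
Proof.
move=> u v w; congr pair => /=; first by rewrite mulrDl.
by rewrite scalerDl scalerDr addrACA.
Qed.

Fact trivext_one_neq0 : trivext_one != 0.
Proof. by rewrite xpair_eqE /= oner_eq0. Qed.

HB.instance Definition _ := GRing.Zmodule_isComNzRing.Build idealization
  trivext_mulA trivext_mulC trivext_mul1 trivext_mulDl trivext_one_neq0.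

(* The algebra structure along a |-> (a, 0). *)
Definition trivext_scale (a : R) u : idealization := ((a, 0) : idealization) * u.

Fact trivext_scaleE a u : trivext_scale a u = (a * u.1, a *: u.2).
Proof. by congr pair => /=; rewrite scaler0 addr0. Qed.

Fact trivext_scaleA a b u :
  trivext_scale a (trivext_scale b u) = trivext_scale (a * b) u.
Proof. by rewrite !trivext_scaleE /= mulrA scalerA. Qed.

Fact trivext_scale1 : left_id 1 trivext_scale.
Proof. by move=> u; apply: mul1r. Qed.

Fact trivext_scaleDr : right_distributive trivext_scale +%R.
Proof. by move=> a u v; apply: mulrDr. Qed.

Fact trivext_scaleDl u : {morph trivext_scale^~ u : a b / a + b}.
Proof. by move=> a b; rewrite !trivext_scaleE mulrDl scalerDl. Qed.

HB.instance Definition _ := GRing.Zmodule_isLmodule.Build R idealization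
  trivext_scaleA trivext_scale1 trivext_scaleDr trivext_scaleDl.

Fact trivext_scaleAl (a : R) u v : a *: (u * v) = (a *: u) * v.
Proof. exact: mulrA. Qed.

HB.instance Definition _ := GRing.Lmodule_isLalgebra.Build R idealization
  trivext_scaleAl.

Fact trivext_scaleAr (a : R) u v : a *: (u * v) = u * (a *: v).
Proof. exact: mulrCA. Qed.

HB.instance Definition _ := GRing.Lalgebra_isAlgebra.Build R idealization
  trivext_scaleAr.

End Idealization.

Notation "R ⋉ M" := (@idealization R M) (at level 40) : type_scope.

Section Submodule.
Variables (S : comNzRingType) (L : lmodType S).

Definition submod (N : submodClosed L) : Type := {x : L | x \in N}.

HB.instance Definition _ (N : submodClosed L) := SubChoice.on (submod N).
HB.instance Definition _ (N : submodClosed L) :=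
  [SubChoice_isSubLmodule of submod N by <:].

End Submodule.

Section QuotientModule.
Variables (S : comNzRingType) (L : lmodType S) (N : submodClosed L).

(* The library's submodClosed does not inherit from zmodClosed, which its
   quotients require. *)
Definition submod_zmod : {pred L} := [pred x | x \in N].

Fact submod_zmod_closed : zmod_closed submod_zmod.
Proof.
split=> [|x y]; rewrite !inE ?rpred0 // => xN yN.
by rewrite -scaleN1r rpredD ?rpredZ.
Qed.

HB.instance Definition _ :=
  GRing.isZmodClosed.Build L submod_zmod submod_zmod_closed.

Definition quotmod : Type := Quotient.quot submod_zmod.

HB.instance Definition _ := GRing.Zmodule.on quotmod.

Local Notation q := (\pi_(Quotient.quot submod_zmod))%qT.

Definition quotmod_scale (a : S) (u : quotmod) : quotmod := q (a *: repr u).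

Fact pi_scale (a : S) (x : L) : quotmod_scale a (q x) = q (a *: x).
Proof.
apply/eqP; rewrite /quotmod_scale -Quotient.idealrBE -scalerBr.
have xN : repr (q x) - x \in submod_zmod by rewrite Quotient.idealrBE reprK.
exact: (rpredZ a (xN : _ \in N)).
Qed.

Fact quotmod_scaleA a b u :
  quotmod_scale a (quotmod_scale b u) = quotmod_scale (a * b) u.
Proof. by rewrite {2}/quotmod_scale pi_scale scalerA. Qed.

Fact quotmod_scale1 : left_id 1 quotmod_scale.
Proof. by move=> u; rewrite /quotmod_scale scale1r reprK. Qed.

Fact quotmod_scaleDr : right_distributive quotmod_scale +%R.
Proof.
move=> a u v; rewrite -[u]reprK -[v]reprK.
by rewrite -[X in quotmod_scale a X]raddfD !pi_scale scalerDr raddfD.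
Qed.

Fact quotmod_scaleDl u : {morph quotmod_scale^~ u : a b / a + b}.
Proof. by move=> a b; rewrite /quotmod_scale scalerDl raddfD. Qed.

HB.instance Definition _ := GRing.Zmodule_isLmodule.Build S quotmod
  quotmod_scaleA quotmod_scale1 quotmod_scaleDr quotmod_scaleDl.

End QuotientModule.

Section Subquotient.
Variables (S : comNzRingType) (L : lmodType S) (A B : submodClosed L).

Definition in_submod : pred (submod A) := fun x => val x \in B.

Fact in_submod_closed : submod_closed in_submod.
Proof.
split=> [|a x y xB yB]; first exact: (rpred0 B).
exact: (rpredD (rpredZ a (xB : val x \in B)) (yB : val y \in B)).
Qed.

HB.instance Definition _ :=
  GRing.isSubmodClosed.Build S (submod A) in_submod in_submod_closed.

Definition sub_in : submodClosed (submod A) :=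
  GRing.SubmodClosed.clone _ _ in_submod _.

(* A / (A ∩ B), i.e. A / B when B is contained in A. *)
Definition subquot : lmodType S := quotmod sub_in.

End Subquotient.

Section Finiteness.
Variables (S : comNzRingType) (L : lmodType S).

Definition fin_gen : Prop :=
  exists s : seq L, forall x : L,
    exists c : nat -> S, x = \sum_(i < size s) c i *: s`_i.

End Finiteness.

Definition noetherian (S : comNzRingType) : Prop :=
  forall I : submodClosed S^o, fin_gen (submod I).

Definition maximal_ideal (S : comNzRingType) (m : {pred S}) : Prop :=
  idealr_closed m /\
  forall J : {pred S}, idealr_closed J -> {subset m <= J} -> J =i m.

Definition local_with (S : comNzRingType) (m : {pred S}) : Prop :=
  maximal_ideal m /\ forall m' : {pred S}, maximal_ideal m' -> m' =i m.

Definition local_ring (S : comNzRingType) : Prop :=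
  exists m : {pred S}, local_with m.

Section Dimension.
Variables (S : comNzRingType) (L : lmodType S).

Definition annihilates (a : S) : Prop := forall x : L, a *: x = 0.

(* A chain p_0 < ... < p_n of primes containing Ann L. *)
Definition prime_chain (n : nat) (p : 'I_n.+1 -> prime_idealr S) : Prop :=
  (forall i a, annihilates a -> a \in p i) /\
  (forall i j : 'I_n.+1, (i < j)%N ->
     {subset p i <= p j} /\ ~ {subset p j <= p i}).

Definition has_chain (n : nat) : Prop := exists p, @prime_chain n p.

(* dim L = dim S / Ann L.  dim_le holds of the zero module for all n, which is
   the convention dim 0 = -oo, and dim_eq for no n. *)
Definition dim_le (n : nat) : Prop := forall k, has_chain k -> (k <= n)%N.
Definition dim_eq (n : nat) : Prop := has_chain n /\ dim_le n.
Definition fin_dim : Prop := exists n, dim_le n.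

End Dimension.

Section CohenMacaulay.
Variables (S : comNzRingType) (L : lmodType S).

(* x \in (xs) L *)
Definition in_smul (xs : seq S) (x : L) : Prop :=
  exists f : nat -> L, x = \sum_(i < size xs) xs`_i *: f i.

Definition regular_seq (xs : seq S) : Prop :=
  (forall i, (i < size xs)%N -> forall x : L,
     in_smul (take i xs) (xs`_i *: x) -> in_smul (take i xs) x) /\
  (exists x : L, ~ in_smul xs x).

Definition depth_eq (m : {pred S}) (n : nat) : Prop :=
  (exists xs, [/\ size xs = n, {subset xs <= m} & regular_seq xs]) /\
  (forall xs, {subset xs <= m} -> regular_seq xs -> (size xs <= n)%N).

(* Nonzero Cohen-Macaulay modules over a local ring (S, m); no localization is
   involved, so this is false over a ring S that is not local. *)
Definition cohen_macaulay : Prop :=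
  exists m n, [/\ local_with m, fin_gen L, dim_eq L n & depth_eq m n].

End CohenMacaulay.

Section SequentiallyCohenMacaulay.
Variables (S : comNzRingType) (L : lmodType S).

(* d belongs to the set of dimensions of the nonzero submodules of L *)
Definition sub_dim (d : nat) : Prop :=
  exists N : submodClosed L,
    (exists2 x, x \in N & x != 0) /\ dim_eq (submod N) d.

Definition largest_dim_le (n : nat) (D : submodClosed L) : Prop :=
  dim_le (submod D) n /\
  forall N : submodClosed L, dim_le (submod N) n -> {subset N <= D}.

(* ds lists d_1 < ... < d_l, so d_(i+1) is ds`_i. *)
Definition dimension_filtration
    (ds : seq nat) (D : nat -> submodClosed L) : Prop :=
  [/\ sorted ltn ds,
      forall d, d \in ds <-> sub_dim d,
      forall x, x \in D 0%N -> x = 0,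
      forall i, (i < size ds)%N -> largest_dim_le (nth 0%N ds i) (D i.+1) &
      forall x, x \in D (size ds)].

Definition seqCM_module : Prop :=
  [/\ exists x : L, x != 0, fin_gen L, fin_dim L &
      exists ds D, dimension_filtration ds D /\
        forall i, (i < size ds)%N -> cohen_macaulay (subquot (D i.+1) (D i))].

End SequentiallyCohenMacaulay.

Definition seqCM_ring (S : comNzRingType) : Prop :=
  [/\ noetherian S, fin_dim S^o & seqCM_module S^o].

Definition seqCM_local_ring (S : comNzRingType) : Prop :=
  local_ring S /\ seqCM_ring S.

(* Main.v *)
(* Let F_n(L) be the submodule of the elements u of L with dim S u < n. Then L is
   sequentially Cohen-Macaulay iff each F_(d+1)(L) / F_d(L) is zero or has depth
   at least d; a nonzero such quotient always has dimension d, and depth never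
   exceeds dimension.

   Over R, F_n of R ⋉ M is F_n(R) x F_n(M), so everything reduces to finding a
   regular sequence common to two modules that both have depth at least d: by
   prime avoidance the last terms of the two sequences can be replaced by a
   common one, which is then rotated to the front.

   Over A = R ⋉ M, the primes are the p x M, so the filtrations F_n over A and
   over R agree. Since (a, x)^2 = (a, 2x) (a, 0), the last term (a, x) of a regular
   sequence over A can be replaced by (a, 0); rotating it to the front and
   repeating turns the sequence into one coming from R. *)
From HB Require Import structures.
Require Import Defs.
From mathcomp Require Import all_boot all_order all_algebra.
From mathcomp Require Import ring_quotient generic_quotient boolp.

Set Implicit Arguments.
Unset Strict Implicit.
Unset Printing Implicit Defensive.

Import GRing.Theory.
Local Open Scope ring_scope.

(** * Submodules and Noetherian rings *)

Section Span.
Variables (S : comNzRingType) (L : lmodType S).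
Implicit Types (A B : L -> Prop) (s t : seq L) (x y : L).

(** Predicates in [Prop] let submodules be given by logical formulas; [submodule_closed] turns them
    classically into bundled boolean ones. *)
Definition submodule A := A 0 /\ forall a x y, A x -> A y -> A (a *: x + y).

Lemma submod0 A : submodule A -> A 0. Proof. by case. Qed.

Lemma submodD A x y : submodule A -> A x -> A y -> A (x + y).
Proof. by case=> _ hA Ax Ay; rewrite -[x]scale1r; apply: hA. Qed.

Lemma submodZ A a x : submodule A -> A x -> A (a *: x).
Proof. by case=> A0 hA Ax; rewrite -[_ *: _]addr0; apply: hA. Qed.

Lemma submodB A x y : submodule A -> A x -> A y -> A (x - y).
Proof.
by move=> sA Ax Ay; apply: submodD => //; rewrite -scaleN1r; apply: submodZ.
Qed.

Lemma submod_addr A x y : submodule A -> A y -> A (x + y) -> A x.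
Proof. by move=> sA Ay Axy; rewrite -(addrK y x); apply: submodB. Qed.

Lemma submodI A B : submodule A -> submodule B -> submodule (fun x => A x /\ B x).
Proof.
move=> [A0 hA] [B0 hB]; split=> // a x y [Ax Bx] [Ay By].
by split; [apply: hA|apply: hB].
Qed.

Lemma submodT : submodule (fun _ => True). Proof. by []. Qed.

Lemma submod_zero : submodule (fun x => x = 0).
Proof. by split=> // a x y -> ->; rewrite scaler0 addr0. Qed.

Lemma submod_sum A n (f : 'I_n -> L) :
  submodule A -> (forall i, A (f i)) -> A (\sum_(i < n) f i).
Proof.
move=> sA Af; elim/big_ind: _ => // [|x y Ax Ay]; first exact: submod0.
exact: submodD.
Qed.

Lemma closed_submodule (N : submodClosed L) : submodule (fun x => x \in N).
Proof.
by split=> [|a x y xN yN]; [apply: rpred0|apply: rpredD => //; apply: rpredZ].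
Qed.

Lemma submodule_closed A :
  submodule A -> exists N : submodClosed L, forall x, (x \in N) = `[< A x >].
Proof.
move=> [A0 hA]; pose p : pred L := fun x => `[< A x >].
have cp : submod_closed p.
  split; first exact/asboolP.
  by move=> a x y /asboolP Ax /asboolP Ay; apply/asboolP; apply: hA.
pose hp := GRing.isSubmodClosed.Build S L p cp.
by exists (HB.pack_for (submodClosed L) p hp).
Qed.

(** Recursion splits off one coefficient at a time, which suits induction on the number of
    generators. *)
Fixpoint span s x : Prop :=
  if s is g :: s' then exists a, span s' (x - a *: g) else x = 0.

Lemma span_submodule s : submodule (span s).
Proof.
elim: s => [|g s [IH0 IH]]; first exact: submod_zero.
split=> [|a x y [b xb] [c yc]] /=; first by exists 0; rewrite scale0r subr0.
exists (a * b + c); rewrite scalerDl -scalerA opprD addrACA -scalerBr.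
exact: IH.
Qed.

Lemma span_cons g s x : span s x -> span (g :: s) x.
Proof. by exists 0; rewrite scale0r subr0. Qed.

Lemma span_head g s : span (g :: s) g.
Proof. by exists 1; rewrite scale1r subrr; apply: submod0 (span_submodule s). Qed.

Lemma span_mem s x : x \in s -> span s x.
Proof.
elim: s => // g s IH; rewrite inE => /orP[/eqP-> |/IH]; first exact: span_head.
exact: span_cons.
Qed.

Lemma span_min A s x :
  submodule A -> (forall g, g \in s -> A g) -> span s x -> A x.
Proof.
move=> sA; elim: s x => [|g s IH] x As /= => [->|[a xs]]; first exact: submod0.
rewrite -(subrK (a *: g) x); apply: submodD => //.
  by apply: IH xs => h hs; apply: As; rewrite inE hs orbT.
by apply: submodZ => //; apply: As; rewrite mem_head.
Qed.

Lemma spanP s x :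
  span s x <-> exists c : nat -> S, x = \sum_(i < size s) c i *: s`_i.
Proof.
split=> [|[c ->]]; last first.
  apply: submod_sum => [|i]; first exact: span_submodule.
  apply: submodZ; first exact: span_submodule.
  by apply: span_mem; apply: mem_nth.
elim: s x => [|g s IH] x /= => [->|[a /IH[c xc]]].
  by exists (fun=> 0); rewrite big_ord0.
exists (fun i => if i is j.+1 then c j else a).
by rewrite big_ord_recl /= -xc addrC subrK.
Qed.

Lemma fin_genP : fin_gen L <-> exists s, forall x, span s x.
Proof. by split=> -[s hs]; exists s => x; apply/spanP; apply: hs. Qed.

Definition noeth_mod :=
  forall A, submodule A -> exists s, forall x, A x <-> span s x.

Lemma noeth_mod_fin_gen : noeth_mod -> fin_gen L.
Proof.
move=> nL; have [s hs] := nL _ submodT.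
by apply/fin_genP; exists s => x; apply/hs.
Qed.

Lemma fin_gen_submod (N : submodClosed L) :
  fin_gen (submod N) -> exists s, forall x, x \in N <-> span s x.
Proof.
case=> s hs; exists (map val s) => x; split=> [xN|]; last first.
  apply: (span_min (closed_submodule N)).
  by move=> g /mapP[u _ ->]; apply: valP.
have [c xc] := hs (Sub x xN); apply/spanP; exists c.
have -> : x = val (Sub x xN : submod N) by rewrite SubK.
rewrite xc raddf_sum size_map; apply: eq_bigr => i _.
by rewrite (nth_map 0).
Qed.

End Span.

Lemma noetherianP (S : comNzRingType) : noetherian S -> noeth_mod S^o.
Proof.
move=> nS A sA; have [N hN] := submodule_closed sA.
have [s hs] := fin_gen_submod (nS N).
by exists s => x; rewrite -hs hN asboolE.
Qed.

Lemma noeth_mod_noetherian (S : comNzRingType) : noeth_mod S^o -> noetherian S.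
Proof.
move=> nS I; have [s hs] := nS _ (closed_submodule I).
have sI g : g \in s -> g \in I by move=> /span_mem /hs.
have [t eq_s] : exists t : seq (submod I), map val t = s.
  exists (pmap insub s); elim: s sI {hs} => //= g s IH sI.
  rewrite insubT ?sI ?mem_head //= => gI; rewrite IH // => h hs.
  by apply: sI; rewrite inE hs orbT.
exists t => x; have /hs : val x \in I := valP x.
rewrite -eq_s => /spanP[c xc]; exists c; apply: val_inj.
rewrite xc raddf_sum size_map; apply: eq_bigr => i _.
by rewrite (nth_map 0).
Qed.

(** Induction on the number of generators. For [A] inside the span of [g :: s], the coefficients of
    [g] on elements of [A] form an ideal; lifts to [A] of generators of this ideal, together with
    generators of the part of [A] inside [span s], generate [A]. *)
Lemma fin_gen_noeth_mod (S : comNzRingType) (L : lmodType S) :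
  noeth_mod S^o -> fin_gen L -> noeth_mod L.
Proof.
move=> nS /fin_genP[s0 hs0] A; have: forall x, A x -> span s0 x by [].
elim: s0 A {hs0} => [|g s IH] A As sA.
  by exists [::] => x; split=> [/As|->] //; apply: submod0.
have ss := span_submodule s.
pose I a := exists2 x, A x & span s (x - a *: g).
have sI : submodule (L := S^o) I.
  split; first by exists 0; [apply: submod0|rewrite scale0r subr0; apply: submod0].
  move=> c a b [x Ax xa] [y Ay yb]; exists (c *: x + y); first exact: sA.2.
  rewrite [_ *: a]/(c * a) scalerDl -scalerA opprD addrACA -scalerBr.
  exact: ss.2.
have [u hu] := nS I sI.
have [||t ht] := IH (fun x => A x /\ span s x); first by move=> x [].
  exact: submodI.
have [v [Av hv]] : exists v, (forall x, x \in v -> A x) /\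
    forall a : S^o, span u a -> exists2 y, span v y & span s (y - a *: g).
  have: forall a, a \in u -> I a by move=> a /span_mem /hu.
  elim: u {hu} => [|b u IHu] Iu.
    exists [::]; split=> // a ->; exists 0 => //.
    by rewrite scale0r subr0; apply: submod0.
  have [x Ax xb] := Iu b (mem_head _ _).
  have [|v [Av hv]] := IHu; first by move=> a au; apply: Iu; rewrite inE au orbT.
  exists (x :: v); split=> [y|a [c ac]].
    by rewrite inE => /orP[/eqP->|/Av].
  have [y vy ya] := hv _ ac; exists (c *: x + y).
    by exists c; rewrite addrC addKr.
  have -> : c *: x + y - a *: g = c *: (x - b *: g) + (y - (a - c *: b) *: g).
    by rewrite [c *: b]/(c * b) scalerBr scalerBl scalerA opprB addrACA addKr.
  exact: ss.2.
exists (v ++ t) => x; split=> [Ax|]; last first.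
  apply: (span_min sA) => y; rewrite mem_cat => /orP[/Av //|/span_mem/ht[]//].
have [a xa] := As x Ax.
have [|y vy ya] := hv a; first by apply/hu; exists x.
have sub_v z : span v z -> span (v ++ t) z.
  apply: (span_min (span_submodule _)) => w vw.
  by apply: span_mem; rewrite mem_cat vw.
rewrite -(subrK y x); apply: submodD (sub_v _ vy); first exact: span_submodule.
have Ay : A y by move: vy; apply: (span_min sA).
have : span t (x - y).
  apply/ht; split; first exact: submodB.
  by rewrite -(subrKA (a *: g)) -[_ - y]opprB; apply: submodB.
apply: (span_min (span_submodule _)) => w tw.
by apply: span_mem; rewrite mem_cat tw orbT.
Qed.

(** * Maximal ideals with a property, primes, and units of local rings *)

Section NoetherianRing.
Variables (S : comNzRingType) (nS : noeth_mod S^o).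

Local Notation ideal := (submodule (L := S^o)).

Lemma idealMl (I : S -> Prop) a x : ideal I -> I x -> I (a * x).
Proof. exact: (submodZ (L := S^o)). Qed.

Lemma idealD1 (I : S -> Prop) a :
  ideal I -> ideal (fun x => exists c, I (x - c * a)).
Proof.
move=> sI; split=> [|c x y [b xb] [d yd]].
  by exists 0; rewrite mul0r subr0; apply: submod0 sI.
exists (c * b + d); rewrite mulrDl -mulrA opprD addrACA -mulrBr.
exact: sI.2.
Qed.

(** Otherwise choice yields a strictly ascending sequence of ideals; its union is finitely
    generated, so one term contains it all, a contradiction. *)
Lemma noeth_max (Phi : (S -> Prop) -> Prop) (I0 : S -> Prop) :
  (forall I, Phi I -> ideal I) -> Phi I0 ->
  exists I, [/\ Phi I, forall x, I0 x -> I x &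
    forall J, Phi J -> (forall x, I x -> J x) -> forall x, J x -> I x].
Proof.
move=> idP PI0; apply: contrapT => nmax.
pose T := {I | Phi I /\ forall x, I0 x -> I x}.
have /choice[f hf] (t : T) : exists t' : T,
    (forall x, sval t x -> sval t' x) /\ ~ (forall x, sval t' x -> sval t x).
  case: t => I [PI I0I] /=; apply: contrapT => nI; apply: nmax.
  exists I; split=> // J PJ IJ; apply: contrapT => nJI; apply: nI.
  by exists (exist _ J (conj PJ (fun x I0x => IJ x (I0I x I0x)))).
pose u n : T := iter n f (exist _ I0 (conj PI0 (fun x I0x => I0x))).
have idu n : ideal (sval (u n)) by apply: idP; case: (svalP (u n)).
have u_le m n x : (m <= n)%N -> sval (u m) x -> sval (u n) x.
  by move=> /subnK<-; elim: (n - m)%N => //= k IH /IH; apply: (hf (u _)).1.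
have [|s hs] := nS (A := fun x => exists n, sval (u n) x).
  split; first by exists 0%N; apply: submod0 (idu _).
  move=> a x y [m xm] [n yn]; exists (maxn m n).
  apply: (idu _).2; first exact: u_le (leq_maxl _ _) xm.
  exact: u_le (leq_maxr _ _) yn.
have [N hN] : exists N, forall g, g \in s -> sval (u N) g.
  have: forall g, g \in s -> exists n, sval (u n) g.
    by move=> g /span_mem/hs.
  elim: s {hs} => [|g s IH] gs; first by exists 0%N.
  have [|N hN] := IH; first by move=> h hs; apply: gs; rewrite inE hs orbT.
  have [n gn] := gs g (mem_head _ _); exists (maxn N n) => h.
  rewrite inE => /orP[/eqP->|/hN]; first exact: u_le (leq_maxr _ _) gn.
  exact: u_le (leq_maxl _ _).
apply: (hf (u N)).2 => x ux; apply: (span_min (idu N) hN).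
by apply/hs; exists N.+1.
Qed.

Lemma prime_idealP (P : S -> Prop) :
  ideal P -> ~ P 1 -> (forall a b, P (a * b) -> P a \/ P b) ->
  exists p : prime_idealr S, forall x, x \in p <-> P x.
Proof.
move=> [P0 PI] P1 PM; pose p : pred S := fun x => `[< P x >].
have hi : idealr_closed p.
  split; [exact/asboolP | exact/asboolP | ].
  by move=> a u v /asboolP Pu /asboolP Pv; apply/asboolP; apply: PI.
have hp : prime_idealr_closed p.
  move=> a b /asboolP/PM[Pa|Pb]; apply/orP; [left|right]; exact/asboolP.
pose h1 := isIdealr.Build S p hi.
pose h2 := isPrimeIdealrClosed.Build S p hp.
exists (HB.pack_for (prime_idealr S) p h1 h2) => x.
by split=> [/asboolP|Px] //; apply/asboolP.
Qed.

(** An ideal [P] containing [I] and maximal among those avoiding [T] is prime: if it contains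
    neither [a] nor [b], then [P + (a)] and [P + (b)] meet [T] in some [t] and [v], and [t * v]
    would lie in [P] if [a * b] did. *)
Lemma exists_prime (I T : S -> Prop) :
  ideal I -> T 1 -> (forall a b, T a -> T b -> T (a * b)) ->
  (forall a, I a -> ~ T a) ->
  exists p : prime_idealr S,
    (forall a, I a -> a \in p) /\ (forall a, a \in p -> ~ T a).
Proof.
move=> sI T1 TM IT.
have [||P [[sP PT] IP maxP]] := noeth_max (I0 := I)
    (Phi := fun J => ideal J /\ forall a, J a -> ~ T a).
- by move=> J [].
- by [].
have meetT a : ~ P a -> exists c t, T t /\ P (t - c * a).
  move=> nPa; apply: contrapT => nT; apply: nPa.
  apply: (maxP (fun x => exists c, P (x - c * a))).
  - split; first exact: idealD1.
    by move=> t [c tc] Tt; apply: nT; exists c, t.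
  - by move=> x Px; exists 0; rewrite mul0r subr0.
  by exists 1; rewrite mul1r subrr; apply: submod0 sP.
have [|a b Pab|p hp] := prime_idealP sP.
- by move=> /PT; apply.
- apply: contrapT => /not_orP[/meetT[c [t [Tt Pt]]] /meetT[d [v [Tv Pv]]]].
  apply: (PT (t * v)); last exact: TM.
  have -> : t * v = v * (t - c * a) + c * a * (v - d * b) + c * d * (a * b).
    rewrite !mulrBr [v * t]mulrC [v * _]mulrC addrA subrK.
    by rewrite -[c * a * _]mulrA [a * (d * b)]mulrCA [c * (d * _)]mulrA subrK.
  apply: (submodD sP); last exact: idealMl.
  by apply: (submodD sP); apply: idealMl.
by exists p; split=> a => [/IP|]; rewrite hp //; apply: PT.
Qed.

Variables (m : {pred S}) (loc : local_with m).

Lemma local_ideal : ideal (fun x => x \in m).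
Proof. by case: loc => -[[m0 _ mD] _] _; split=> // a x y xm ym; apply: mD. Qed.

Lemma local_proper : 1 \notin m.
Proof. by case: loc => -[[]]. Qed.

(** If [a] had no inverse, some proper ideal containing [a] would be maximal, hence equal to [m]. *)
Lemma local_unit a : a \notin m -> exists b, b * a = 1.
Proof.
move=> am; apply: contrapT => na.
have [||P [[sP P1] aP maxP]] := noeth_max (I0 := fun x => exists c, x = c * a)
    (Phi := fun J => ideal J /\ ~ J 1).
- by move=> J [].
- split; last by case=> b ba; apply: na; exists b.
  split; first by exists 0; rewrite mul0r.
  by move=> c x y [b ->] [d ->]; exists (c * b + d); rewrite mulrDl -mulrA.
have maxm : maximal_ideal (fun x => `[< P x >]).
  split.
    split; [apply/asboolP; exact: submod0 sP|exact/asboolP|].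
    by move=> b x y /asboolP Px /asboolP Py; apply/asboolP; apply: sP.2.
  move=> J [J0 J1 JD] PJ x; apply/idP/idP; last exact: PJ.
  move=> Jx; apply/asboolP; apply: (maxP (fun x => x \in J)) Jx.
    split; last exact/negP.
    by split=> // b y z Jy Jz; apply: JD.
  by move=> y Py; apply: PJ; apply/asboolP.
move: am; rewrite -(loc.2 _ maxm) => /asboolP; apply.
by apply: aP; exists 1; rewrite mul1r.
Qed.

Lemma local_unit1B a : a \in m -> exists b, b * (1 - a) = 1.
Proof.
move=> am; apply: local_unit; apply/negP => bm.
case/negP: local_proper; rewrite -(subrK a 1).
exact: (submodD local_ideal).
Qed.

End NoetherianRing.

(** * Regular sequences *)

Lemma prime_avoidance (S : comNzRingType) (T : eqType) (P : T -> S -> Prop)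
    (I : S -> Prop) (s : seq T) :
  submodule (L := S^o) I ->
  (forall t, t \in s -> submodule (L := S^o) (P t)) ->
  (forall t, t \in s -> forall a b, P t (a * b) -> P t a \/ P t b) ->
  (forall t, t \in s -> exists2 a, I a & ~ P t a) ->
  exists2 z, I z & forall t, t \in s -> ~ P t z.
Proof.
move=> sI; have [n] := ubnP (size s).
elim: n s => // n IH [|t s] /= sz sP pP nP; first by exists 0; [apply: submod0 sI|].
have ts := mem_head t s.
have ss u : u \in s -> u \in t :: s by rewrite inE orbC => ->.
have [[u us Put]|nsub] := EM (exists2 u, u \in s & forall a, P u a -> P t a).
  have rs v : v \in t :: rem u s -> v \in t :: s.
    by rewrite !inE => /orP[->//|/mem_rem->]; rewrite orbT.
  have [||||z Iz nz] := IH (t :: rem u s).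
  - by rewrite /= size_rem //; case: (s) us sz.
  - by move=> v /rs/sP.
  - by move=> v /rs/pP.
  - by move=> v /rs/nP.
  exists z => // v; rewrite inE (perm_mem (perm_to_rem us)) inE orbCA -in_cons.
  by case/orP=> [/eqP-> /Put|/nz //]; apply: nz; rewrite mem_head.
have [||||z Iz nz] := IH s; [exact: sz|by move=> u /ss/sP|by move=> u /ss/pP| |].
  by move=> u /ss/nP.
have [w [Iw Ptw Psw]] : exists w, [/\ I w, ~ P t w & forall u, u \in s -> P u w].
  have : forall u, u \in s -> exists2 a, P u a & ~ P t a.
    move=> u us; apply: contrapT => na; apply: nsub; exists u => // a Pua.
    by apply: contrapT => nPta; apply: na; exists a.
  have : forall u, u \in s -> submodule (L := S^o) (P u) by move=> u /ss/sP.
  elim: (s) => [|u r IHr] sr hr.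
    by have [a Ia nPa] := nP t ts; exists a.
  have [||w [Iw Ptw Pw]] := IHr.
  - by move=> v vr; apply: sr; rewrite inE vr orbT.
  - by move=> v vr; apply: hr; rewrite inE vr orbT.
  have [a Pua Pta] := hr u (mem_head _ _).
  exists (a * w); split; first exact: idealMl.
    by case/(pP t ts).
  move=> v; rewrite inE => /orP[/eqP->|vr].
    by rewrite mulrC; apply: idealMl Pua; apply: sr; rewrite mem_head.
  by apply: idealMl (Pw v vr); apply: sr; rewrite inE vr orbT.
have [Ptz|nPtz] := EM (P t z); last first.
  by exists z => // u; rewrite inE => /orP[/eqP->|/nz].
exists (z + w); first exact: (submodD sI).
move=> u; rewrite inE => /orP[/eqP->|us] Pzw.
  by apply: Ptw; apply: (submod_addr (sP t ts) Ptz); rewrite addrC.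
by apply: (nz u us); apply: (submod_addr (sP u (ss u us)) (Psw u us)).
Qed.

Section RegularSequences.
Variables (S : comNzRingType) (L : lmodType S).
Implicit Types (A B : L -> Prop) (u v w : L) (x y z : S) (xs ys : seq S).

(* A pair of submodules (A, B) of L stands for the module A / (A ∩ B), so that
   quotients by regular elements only enlarge B: [addx A B x] is B + x A. *)
Definition reg_on A B x := forall u, A u -> B (x *: u) -> B u.

Definition addx A B x u := exists2 v, A v & B (u - x *: v).

Fixpoint preg A B xs : Prop :=
  if xs is x :: xs' then reg_on A B x /\ preg A (addx A B x) xs' else True.

(** This is [B + (xs) A], as [modbyP] makes explicit. *)
Fixpoint modby A B xs : L -> Prop :=
  if xs is x :: xs' then modby A (addx A B x) xs' else B.

Lemma addx_submodule A B x :
  submodule A -> submodule B -> submodule (addx A B x).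
Proof.
move=> [A0 hA] [B0 hB]; split; first by exists 0 => //; rewrite scaler0 subr0.
move=> a u v [u' Au Bu] [v' Av Bv]; exists (a *: u' + v'); first exact: hA.
by rewrite scalerDr scalerA mulrC -scalerA opprD addrACA -scalerBr; apply: hB.
Qed.

Lemma addx_sub A B x u : submodule A -> B u -> addx A B x u.
Proof. by move=> [A0 _] Bu; exists 0 => //; rewrite scaler0 subr0. Qed.

Lemma addxC A B x y : addx A (addx A B x) y = addx A (addx A B y) x.
Proof.
by apply/predeqP=> u; split=> -[v Av [w Aw Bu]]; exists w => //; exists v => //;
  rewrite addrAC.
Qed.

Lemma modby_submodule A B xs :
  submodule A -> submodule B -> submodule (modby A B xs).
Proof.
move=> sA; elim: xs B => //= x xs IH B sB.
by apply: IH; apply: addx_submodule.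
Qed.

Lemma preg_rcons A B xs z :
  preg A B (rcons xs z) <-> preg A B xs /\ reg_on A (modby A B xs) z.
Proof.
elim: xs B => [|x xs IH] B /=; first by split=> -[].
by split=> [[rx /IH[]]|[[rx pxs] rz]] //; split=> //; apply/IH.
Qed.

Section Local.
Variables (m : {pred S}) (nS : noeth_mod S^o) (loc : local_with m).
Hypothesis nL : noeth_mod L.

(** Elimination of generators: the relation for [g] puts [(1 - x * c) *: g] in [B + x (span s)], and
    [1 - x * c] is a unit, so [g] is congruent to [x *: w] modulo [B] with [w] in [span s];
    substitution into the other relations leaves only the generators [s]. *)
Lemma nakayama A B x :
  submodule A -> submodule B -> x \in m ->
  (forall u, A u -> addx A B x u) -> forall u, A u -> B u.
Proof.
move=> sA sB xm hx; have [s hs] := nL sA.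
suff: forall g, g \in s -> B g by move=> Bs u /hs; apply: span_min.
have {hx}: forall g, g \in s -> addx (span s) B x g.
  by move=> g /span_mem/hs/hx[v /hs]; exists v.
elim: s {hs} => // g s IH hx.
have sS := span_submodule s.
have [t [c tc] Bt] := hx g (mem_head _ _).
have [b hb] : exists b, b * (1 - x * c) = 1.
  apply: (local_unit1B nS loc); rewrite mulrC.
  by apply: (idealMl _ (local_ideal loc)).
pose w := b *: (t - c *: g).
have sw : span s w by apply: submodZ.
have Bg : B (g - x *: w).
  have -> : g - x *: w = b *: (g - x *: t).
    rewrite -{1}[g]scale1r -hb -[(b * _) *: g]scalerA /w.
    rewrite [x *: (b *: _)]scalerA [x * b]mulrC -[(b * x) *: _]scalerA -scalerBr.
    by rewrite scalerBl scale1r [x *: (t - _)]scalerBr scalerA opprB addrA subrK.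
  exact: submodZ.
have Bs h : h \in s -> B h.
  apply: IH => {}h hs; have [|v [d vd] Bv] := hx h; first by rewrite inE hs orbT.
  exists (v - d *: g + (d * x) *: w); first by apply: submodD => //; apply: submodZ.
  have -> : h - x *: (v - d *: g + d * x *: w) =
            h - x *: v + (x * d) *: (g - x *: w).
    rewrite scalerDr !scalerBr !scalerA !opprD opprK !addrA.
    by rewrite !mulrA.
  by apply: (submodD sB) => //; apply: (submodZ _ sB).
move=> h; rewrite inE => /orP[/eqP->|/Bs//].
rewrite -(subrK (x *: w) g); apply: submodD => //; apply: submodZ => //.
exact: span_min sw.
Qed.

Lemma reg_swap A B x z :
  submodule A -> submodule B -> x \in m ->
  reg_on A B x -> reg_on A (addx A B x) z ->
  reg_on A B z /\ reg_on A (addx A B z) x.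
Proof.
move=> sA sB xm rx rz; split=> u Au.
  (* The submodule [K] of elements of [A] that [z] sends into [B] is contained in [B + x K], so
     Nakayama's lemma puts it in [B]. *)
  move=> Bzu; apply: (@nakayama (fun u => A u /\ B (z *: u)) B x) => //.
    split; first by rewrite scaler0; split; apply: submod0.
    move=> a v w [Av Bv] [Aw Bw]; split; first exact: sA.2.
    by rewrite scalerDr scalerA mulrC -scalerA; apply: sB.2.
  move=> {Bzu}{}u [{}Au Bzu]; have [v Av Bv] := rz u Au (addx_sub _ sA Bzu).
  exists v => //; split=> //; apply: rx; first exact: submodZ.
  have -> : x *: (z *: v) = z *: u - z *: (u - x *: v).
    by rewrite scalerBr opprB addrC subrK !scalerA mulrC.
  by apply: submodB => //; apply: submodZ.
(* Modulo [B], [x u = z v]; regularity of [z] modulo [x] gives [v = x w], and cancelling [x] leaves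
   [u = z w]. *)
case=> v Av Bv; have [|w Aw Bw] := rz v Av.
  by exists u => //; rewrite -opprB -scaleN1r; apply: submodZ.
exists w => //; apply: rx; first by apply: submodB => //; apply: submodZ.
have -> : x *: (u - z *: w) = x *: u - z *: v + z *: (v - x *: w).
  by rewrite !scalerBr !scalerA [x * z]mulrC addrA subrK.
by apply: submodD => //; apply: submodZ.
Qed.

(** The last term moves to the front by adjacent exchanges; [reg_swap] asks that each term passed
    lie in [m]. *)
Lemma preg_rotate A B xs z :
  submodule A -> submodule B -> all (mem m) xs ->
  preg A B (rcons xs z) -> preg A B (z :: xs).
Proof.
move=> sA; elim: xs B => [|x xs IH] B sB //= /andP[xm xsm] [rx].
case/IH=> [||rz pxs] //; first exact: addx_submodule.
have [rz' rx'] := reg_swap sA sB xm rx rz.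
by rewrite addxC.
Qed.

(* Annihilators of elements of A/B that are maximal among the annihilators of
   nonzero elements are prime, and finitely many of them suffice because the
   submodule spanned by the elements attaining them is finitely generated. *)
Lemma assoc_primes A B : submodule A -> submodule B ->
  exists qs : seq L,
    (forall q, q \in qs -> [/\ A q, ~ B q &
       forall a b, B ((a * b) *: q) -> B (a *: q) \/ B (b *: q)]) /\
    (forall u, A u -> ~ B u ->
       exists2 q, q \in qs & forall a, B (a *: u) -> B (a *: q)).
Proof.
move=> sA sB.
pose W q := [/\ A q, ~ B q & forall q', A q' -> ~ B q' ->
  (forall a, B (a *: q) -> B (a *: q')) -> forall a, B (a *: q') -> B (a *: q)].
have sAnn q : submodule (L := S^o) (fun a => B (a *: q)).
  split; first by rewrite scale0r; apply: submod0.
  by move=> c a b; rewrite scalerDl -scalerA; apply: sB.2.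
have Wprime q : W q -> forall a b, B ((a * b) *: q) -> B (a *: q) \/ B (b *: q).
  move=> [Aq nBq qmax] a b Bab; apply: contrapT => /not_orP[na nb]; apply: na.
  apply: (qmax (b *: q)); rewrite ?scalerA //; first exact: submodZ.
  by move=> c Bc; rewrite scalerA mulrC -scalerA; apply: submodZ.
have exW u : A u -> ~ B u -> exists2 q, W q & forall a, B (a *: u) -> B (a *: q).
  move=> Au nBu; have [||J [[q [Aq nBq ->]] uq qmax]] := noeth_max nS
    (Phi := fun J => exists q, [/\ A q, ~ B q & J = fun a => B (a *: q)])
    (I0 := fun a => B (a *: u)).
  - by move=> I [q [_ _ ->]].
  - by exists u.
  exists q => //; split=> // q' Aq' nBq' qq'.
  by apply: (qmax (fun a => B (a *: q'))) => //; exists q'.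
have [|s hs] := nL (A := fun v => exists2 l, (forall q, q \in l -> W q) & span l v).
  split; first by exists [::].
  move=> a x y [k Wk kx] [l Wl ly]; exists (k ++ l).
    by move=> q; rewrite mem_cat => /orP[/Wk|/Wl].
  apply: (span_submodule _).2.
    apply: span_min kx => [|g gk]; first exact: span_submodule.
    by apply: span_mem; rewrite mem_cat gk.
  apply: span_min ly => [|g gl]; first exact: span_submodule.
  by apply: span_mem; rewrite mem_cat gl orbT.
(* [l] collects the elements of [W] that express the generators [s], so its span contains all of
   [W]. *)
have [l Wl sl] : exists2 l, (forall q, q \in l -> W q) &
    forall g, g \in s -> span l g.
  have : forall g, g \in s -> exists2 l, (forall q, q \in l -> W q) & span l g.
    by move=> g /span_mem/hs.
  elim: s {hs} => [|g s IH] hs; first by exists [::].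
  have [|k Wk sk] := IH; first by move=> h h_s; apply: hs; rewrite inE h_s orbT.
  have [l Wl lg] := hs g (mem_head _ _); exists (k ++ l).
    by move=> q; rewrite mem_cat => /orP[/Wk|/Wl].
  move=> h; rewrite inE => /orP[/eqP->|/sk].
    apply: span_min lg => [|q ql]; first exact: span_submodule.
    by apply: span_mem; rewrite mem_cat ql orbT.
  apply: span_min => [|q qk]; first exact: span_submodule.
  by apply: span_mem; rewrite mem_cat qk.
exists l; split=> [q ql|u Au nBu].
  by have Wq := Wl q ql; split; [case: Wq|case: Wq|apply: Wprime].
have [q Wq uq] := exW u Au nBu.
(* Otherwise take, for each member of [l], an element killing it modulo [B] but not [q]. By
   primality their product does not kill [q], yet it kills [span l], which contains [q]. *)
have [q' q'l qq'] : exists2 q', q' \in l & forall a, B (a *: q') -> B (a *: q).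
  apply: contrapT => nq.
  have [a nBa Ba] : exists2 a, ~ B (a *: q) & forall q', q' \in l -> B (a *: q').
    have : forall q', q' \in l -> exists2 a, B (a *: q') & ~ B (a *: q).
      move=> q' q'l; apply: contrapT => na; apply: nq; exists q' => // a Ba.
      by apply: contrapT => nBa; apply: na; exists a.
    elim: (l) => [|q' k IH] hk; first by exists 1 => //; rewrite scale1r; case: Wq.
    have [|a na Ba] := IH; first by move=> h hk'; apply: hk; rewrite inE hk' orbT.
    have [b Bb nb] := hk q' (mem_head _ _).
    exists (a * b); first by case/(Wprime q Wq).
    move=> h; rewrite inE => /orP[/eqP->|/Ba].
      by rewrite -scalerA; apply: submodZ.
    by rewrite mulrC -scalerA; apply: submodZ.
  apply: nBa; have ql : span l q.
    have /hs: exists2 l, (forall q, q \in l -> W q) & span l q.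
      by exists [:: q]; [move=> h; rewrite inE => /eqP->|apply: span_head].
    by apply: span_min => //; apply: span_submodule.
  apply: (span_min (A := fun v => B (a *: v))) ql => //.
  split; first by rewrite scaler0; apply: submod0.
  by move=> c x y Bx By; rewrite scalerDr scalerA mulrC -scalerA; apply: sB.2.
exists q' => // a /uq; case: (Wl q' q'l) => Aq' nBq' q'max; apply: q'max => //.
  by case: Wq.
by case: Wq.
Qed.

End Local.
End RegularSequences.

(** * Regular sequences common to two modules *)

Section CommonSequence.
Variables (S : comNzRingType) (m : {pred S}).
Hypotheses (nS : noeth_mod S^o) (loc : local_with m).
Variables (L1 L2 : lmodType S) (nL1 : noeth_mod L1) (nL2 : noeth_mod L2).

(** The primes of [assoc_primes] for the two quotients omit [x] and [y] respectively, so none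
    contains [m]; an element of [m] outside all of them is regular on both, as zero divisors lie in
    their union. *)
Lemma common_reg (A1 B1 : L1 -> Prop) (A2 B2 : L2 -> Prop) x y :
  submodule A1 -> submodule B1 -> submodule A2 -> submodule B2 ->
  x \in m -> y \in m -> reg_on A1 B1 x -> reg_on A2 B2 y ->
  exists z, [/\ z \in m, reg_on A1 B1 z & reg_on A2 B2 z].
Proof.
move=> sA1 sB1 sA2 sB2 xm ym rx ry.
have [q1 [hq1 z1]] := assoc_primes nS nL1 sA1 sB1.
have [q2 [hq2 z2]] := assoc_primes nS nL2 sA2 sB2.
pose P (t : L1 + L2) a :=
  match t with inl q => B1 (a *: q) | inr q => B2 (a *: q) end.
have [||||z zm nz] := @prime_avoidance S _ P (fun a => a \in m)
    (map inl q1 ++ map inr q2).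
- exact: local_ideal loc.
- move=> [] q _; split; rewrite /P.
  + by rewrite scale0r; apply: submod0.
  + by move=> c a b; rewrite scalerDl -scalerA; apply: sB1.2.
  + by rewrite scale0r; apply: submod0.
  by move=> c a b; rewrite scalerDl -scalerA; apply: sB2.2.
- move=> t; rewrite mem_cat => /orP[]/mapP[q qq -> /=].
    by case: (hq1 q qq).
  by case: (hq2 q qq).
- move=> t; rewrite mem_cat => /orP[]/mapP[q qq -> /=].
    by exists x => // Bx; case: (hq1 q qq) => Aq nBq _; apply: nBq; apply: rx.
  by exists y => // By; case: (hq2 q qq) => Aq nBq _; apply: nBq; apply: ry.
exists z; split=> // u Au Bu; apply: contrapT => nBu.
  have [q qq uq] := z1 u Au nBu.
  by apply: (nz (inl q)); [rewrite mem_cat map_f|apply: uq].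
have [q qq uq] := z2 u Au nBu.
by apply: (nz (inr q)); [rewrite mem_cat map_f ?orbT|apply: uq].
Qed.

(** Induction on the length with [B1] and [B2] varying: once the common [z] is in front, the
    remaining sequences are regular modulo [z]. *)
Lemma common_preg (A1 B1 : L1 -> Prop) (A2 B2 : L2 -> Prop) xs ys :
  submodule A1 -> submodule B1 -> submodule A2 -> submodule B2 ->
  all (mem m) xs -> all (mem m) ys -> size xs = size ys ->
  preg A1 B1 xs -> preg A2 B2 ys ->
  exists zs, [/\ all (mem m) zs, size zs = size xs, preg A1 B1 zs & preg A2 B2 zs].
Proof.
move=> sA1 + sA2; move en: (size xs) => n.
elim: n xs ys B1 B2 en => [|n IH] xs ys B1 B2.
  by move=> /size0nil-> sB1 sB2 _ _ _ _ _; exists [::].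
case/lastP: xs => [//|xs x]; rewrite size_rcons => -[en] sB1 sB2.
case/lastP: ys => [//|ys y].
rewrite !all_rcons size_rcons => /andP[xm xsm] /andP[ym ysm] [en'].
move=> /preg_rcons[pxs rx] /preg_rcons[pys ry].
have [||z [zm rz1 rz2]] := common_reg sA1 _ sA2 _ xm ym rx ry.
- exact: modby_submodule.
- exact: modby_submodule.
have [||||{}rz1 pz1] := @preg_rotate _ _ m nS loc nL1 A1 B1 xs z => //.
  exact/preg_rcons.
have [||||{}rz2 pz2] := @preg_rotate _ _ m nS loc nL2 A2 B2 ys z => //.
  exact/preg_rcons.
have [||zs [zsm sz p1 p2]] := IH xs ys (addx A1 B1 z) (addx A2 B2 z) en _ _
  xsm ysm en' pz1 pz2; [exact: addx_submodule|exact: addx_submodule|].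
exists (z :: zs); split=> /=; [exact/andP|by rewrite sz|exact: conj|exact: conj].
Qed.

End CommonSequence.

(** * Dimension *)

Section Chains.
Variable S : comNzRingType.
Implicit Types (I J : S -> Prop) (n k : nat).
Local Notation ideal := (submodule (L := S^o)).

(** For [I] the annihilator of a module this unfolds to [has_chain]. *)
Definition chain_over I n : Prop := exists p : 'I_n.+1 -> prime_idealr S,
  (forall i a, I a -> a \in p i) /\
  (forall i j : 'I_n.+1, (i < j)%N ->
     {subset p i <= p j} /\ ~ {subset p j <= p i}).

Lemma chain_over_sub I J n :
  (forall a, J a -> I a) -> chain_over I n -> chain_over J n.
Proof. by move=> JI [p [Ip hp]]; exists p; split=> // i a /JI; apply: Ip. Qed.

Lemma chain_over_min I n (p : 'I_n.+1 -> prime_idealr S) :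
  (forall a, I a -> a \in p ord0) ->
  (forall i j : 'I_n.+1, (i < j)%N ->
     {subset p i <= p j} /\ ~ {subset p j <= p i}) -> chain_over I n.
Proof.
move=> Ip0 hp; exists p; split=> // i a /Ip0 ap0.
have [->//|/eqP i0] := eqVneq i ord0; have [|+ _] := hp ord0 i; last by apply.
by rewrite lt0n; apply/eqP=> i0'; apply: i0; apply: val_inj.
Qed.

(** The bottom prime contains all products of an element of [I] and one of [J], hence contains [I]
    or [J]. *)
Lemma chain_overI I J n : ideal I -> ideal J ->
  chain_over (fun a => I a /\ J a) n -> chain_over I n \/ chain_over J n.
Proof.
move=> sI sJ [p [IJp hp]].
have [Ip|nIp] := EM (forall a, I a -> a \in p ord0).
  by left; apply: chain_over_min hp.
right; apply: chain_over_min hp => // b Jb; apply: contrapT => /negP nb.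
apply: nIp => a Ia; have : a * b \in p ord0.
  by apply: IJp; split; [rewrite mulrC|]; apply: idealMl.
by rewrite prime_idealrM (negPf nb) orbF.
Qed.

Lemma chain_over_proper I n : chain_over I n -> ~ I 1.
Proof. by move=> [p [Ip _]] /(Ip ord0); rewrite idealr1. Qed.

Lemma proper_chain_over I :
  noeth_mod S^o -> ideal I -> ~ I 1 -> chain_over I 0.
Proof.
move=> nS sI I1; have [|||p [Ip _]] := exists_prime nS sI (T := fun a => a = 1).
- by [].
- by move=> a b -> ->; rewrite mulr1.
- by move=> a Ia a1; apply: I1; rewrite -a1.
apply: (chain_over_min (p := fun=> p)) => // i j.
by rewrite (ord1 i) (ord1 j).
Qed.

End Chains.

Section SubquotientDimension.
Variables (S : comNzRingType) (L : lmodType S).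
Implicit Types (A B : L -> Prop).

Definition annq A B (a : S) : Prop := forall u, A u -> B (a *: u).

Lemma annq_ideal A B : submodule B -> submodule (L := S^o) (annq A B).
Proof.
move=> sB; split=> [u _|c a b Aa Ab u Au].
  by rewrite scale0r; apply: submod0.
by rewrite scalerDl -scalerA; apply: sB.2; [apply: Aa|apply: Ab].
Qed.

(* With p_0 the bottom of a chain for A/(B + xA), a prime disjoint from
   {x^k s | s not in p_0} lies strictly below p_0, as x belongs to p_0. *)
Lemma preg_chain A B xs : noeth_mod S^o -> submodule A -> submodule B ->
  preg A B xs -> (exists2 u, A u & ~ modby A B xs u) ->
  chain_over (annq A B) (size xs).
Proof.
move=> nS sA; elim: xs B => [|x xs IH] B sB /=.
  move=> _ [u Au nBu]; apply: proper_chain_over => //; first exact: annq_ideal.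
  by move/(_ u Au); rewrite scale1r.
move=> [rx pxs] hu.
have [p [hp lt_p]] := IH _ (addx_submodule x sA sB) pxs hu.
have xp i : x \in p i.
  by apply: hp => u Au; exists u => //; rewrite subrr; apply: submod0.
pose T a := exists k s, s \notin p ord0 /\ a = x ^+ k * s.
have [||a Aa [k [s [sp ea]]]|q [hq qT]] := exists_prime nS (annq_ideal A sB) (T := T).
- by exists 0%N, 1; rewrite idealr1 mulr1.
- move=> _ _ [k [s [sp ->]]] [l [t [tp ->]]]; exists (k + l)%N, (s * t).
  by rewrite prime_idealrM negb_or sp tp exprD mulrACA.
(* If [x ^+ k * s] kills [A] modulo [B], regularity cancels the powers of [x]; then [s] also kills
   the quotient by [x], so it lies in [p ord0]. *)
- case/negP: sp; apply: hp => u Au; apply: addx_sub => //.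
  have: B ((x ^+ k * s) *: u) by rewrite -ea; apply: Aa.
  elim: k {ea} => [|k IHk]; first by rewrite mul1r.
  rewrite exprS -mulrA -scalerA => /rx Bk; apply: IHk; apply: Bk.
  exact: submodZ.
have qp0 : {subset q <= p ord0}.
  move=> a /qT nTa; apply: contrapT => /negP ap; apply: nTa.
  by exists 0%N, a; rewrite mul1r.
have nxq : x \notin q.
  by apply/negP => /qT; apply; exists 1%N, 1; rewrite idealr1 mulr1.
have p0p i : {subset p ord0 <= p i}.
  have [->//|i0] := eqVneq i ord0; have [|] := lt_p ord0 i => //.
  by rewrite lt0n; apply: contra_neq i0 => i0; apply: val_inj.
pose r (i : 'I_(size xs).+2) := if unlift ord0 i is Some j then p j else q.
apply: (chain_over_min (p := r)) => [a /hq|i j]; rewrite /r ?unlift_none //.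
case: unliftP => [i' ->|->]; case: unliftP => [j' ->|->] //= ij.
  exact: lt_p.
split=> [a /qp0/p0p//|pq]; case/negP: nxq; exact: pq.
Qed.

End SubquotientDimension.

(** * The filtration by the dimension of elements *)

Section DimensionFiltration.
Variables (S : comNzRingType) (L : lmodType S).
Implicit Types (A B : L -> Prop) (u v : L) (n k d : nat).

(* dim (S u) < n; thus [dimlt d.+1] is the largest submodule of dimension at
   most d, and [dimlt 0] is zero. *)
Definition dimlt n u : Prop :=
  forall k, chain_over (fun a : S => a *: u = 0) k -> (k < n)%N.

Lemma ann_ideal u : submodule (L := S^o) (fun a : S => a *: u = 0).
Proof.
split=> [|c a b au bu]; first by rewrite scale0r.
by rewrite scalerDl -[_ *: a]/(c * a) -scalerA au bu scaler0 addr0.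
Qed.

Lemma dimlt_submodule n : submodule (dimlt n).
Proof.
split=> [k /chain_over_proper|a u v hu hv k ch]; first by rewrite scaler0.
have [|/hu|/hv] // := chain_overI (ann_ideal u) (ann_ideal v) (n := k).
apply: chain_over_sub ch => b [bu bv].
by rewrite scalerDr scalerA mulrC -scalerA bu bv scaler0 addr0.
Qed.

Lemma dimlt_le n k u : (n <= k)%N -> dimlt n u -> dimlt k u.
Proof. by move=> nk hu l /hu ln; apply: leq_trans nk. Qed.

Lemma dimlt_chain n u :
  dimlt n.+1 u -> ~ dimlt n u -> chain_over (fun a : S => a *: u = 0) n.
Proof.
move=> hu nu; apply: contrapT => nch; apply: nu => k ch.
have := hu k ch; rewrite ltnS leq_eqVlt => /orP[/eqP kn|//].
by case: nch; rewrite -kn.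
Qed.

Hypothesis nS : noeth_mod S^o.

(** The integer [d] is the dimension of [S u]: the maximal length of a chain over the annihilator of
    [u]. *)
Lemma dimlt_jump n u :
  dimlt n u -> u != 0 -> exists d, [/\ (d < n)%N, dimlt d.+1 u & ~ dimlt d u].
Proof.
move=> hu u0.
have ex0 : exists k, `[< chain_over (fun a : S => a *: u = 0) k >].
  exists 0%N; apply/asboolP; apply: proper_chain_over => //.
    exact: ann_ideal.
  by rewrite scale1r => /eqP; apply/negP.
have ub k : `[< chain_over (fun a : S => a *: u = 0) k >] -> (k <= n)%N.
  by move=> /asboolP/hu/ltnW.
case: (ex_maxnP ex0 ub) => d /asboolP ch dmax; exists d; split.
- exact: hu.
- by move=> k kch; rewrite ltnS; apply: dmax; apply/asboolP.
- by move=> /(_ d ch); rewrite ltnn.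
Qed.

Lemma dimlt0 u : dimlt 0 u -> u = 0.
Proof.
move=> hu; apply/eqP; apply: contraPT hu => u0 hu.
by have [d [//]] := dimlt_jump hu u0.
Qed.

(** The annihilator of a span is the intersection of those of the generators, so by [chain_overI]
    the dimension of a finitely generated module is attained at a generator. *)
Lemma chain_span s k :
  chain_over (fun a : S => forall u : L, span s u -> a *: u = 0) k ->
  exists2 g, g \in s & chain_over (fun a : S => a *: g = 0) k.
Proof.
suff: chain_over (fun a : S => forall u : L, u \in s -> a *: u = 0) k ->
    exists2 g, g \in s & chain_over (fun a : S => a *: g = 0) k.
  move=> + ch; apply; apply: chain_over_sub ch => a as0 u.
  apply: (span_min (A := fun v => a *: v = 0)) => //.
  split=> [|c v w /= av aw]; first exact: scaler0.
  by rewrite scalerDr scalerA mulrC -scalerA av aw scaler0 addr0.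
elim: s => [|g s IH]; first by move=> /chain_over_proper[].
move=> ch; have [|||chg|/IH[h hs chh]] := chain_overI (I := fun a : S => a *: g = 0)
  (J := fun a : S => forall u : L, u \in s -> a *: u = 0) (n := k).
- exact: ann_ideal.
- split=> [u _|c a b ha hb u us]; first exact: scale0r.
  by rewrite scalerDl -[_ *: a]/(c * a) -scalerA ha // hb // scaler0 addr0.
- apply: chain_over_sub ch => a [ag ah] u.
  by rewrite inE => /orP[/eqP->|/ah].
- by exists g; rewrite ?mem_head.
by exists h; rewrite // inE hs orbT.
Qed.

Lemma annihilates_submod (N : submodClosed L) a :
  annihilates (submod N) a <-> forall u, u \in N -> a *: u = 0.
Proof.
split=> [h u uN|h x]; last by apply: val_inj; apply: h; apply: valP.
by have /(congr1 val) := h (Sub u uN).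
Qed.

Hypothesis nL : noeth_mod L.

Lemma dim_le_submod (N : submodClosed L) n :
  dim_le (submod N) n <-> forall u, u \in N -> dimlt n.+1 u.
Proof.
split=> [hN u uN k ch|hN k ch].
  apply: hN; apply: chain_over_sub ch => a /annihilates_submod; exact.
have [s hs] := nL (closed_submodule N).
have [|g /span_mem/hs/hN gn /gn//] := @chain_span s k.
by apply: chain_over_sub ch => a ha; apply/annihilates_submod => u /hs/ha.
Qed.

Lemma sub_dimP d : sub_dim L d <-> exists2 u, dimlt d.+1 u & ~ dimlt d u.
Proof.
split=> [[N [_ [ch /dim_le_submod hN]]]|[u ud nud]].
  have [s hs] := nL (closed_submodule N).
  have [|g /span_mem/hs/hN gn chg] := @chain_span s d.
    by apply: chain_over_sub ch => a ha; apply/annihilates_submod => u /hs/ha.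
  by exists g => // /(_ d chg); rewrite ltnn.
have [N hN] := submodule_closed (dimlt_submodule d.+1).
have uN : u \in N by rewrite hN; apply/asboolP.
exists N; split.
  exists u => //; apply: contra_not_neq nud => ->.
  exact: submod0 (dimlt_submodule d).
split; last by apply/dim_le_submod => v; rewrite hN => /asboolP.
by apply: chain_over_sub (dimlt_chain ud nud) => a /annihilates_submod; exact.
Qed.

Lemma largest_dim_leP n (N : submodClosed L) :
  largest_dim_le n N <-> forall u, u \in N <-> dimlt n.+1 u.
Proof.
split=> [[/dim_le_submod hN maxN] u|hN]; last first.
  split; first by apply/dim_le_submod => u /hN.
  by move=> N' /dim_le_submod hN' u /hN'/hN.
split; first exact: hN.
have [N' hN'] := submodule_closed (dimlt_submodule n.+1) => un.
apply: (maxN N'); last by rewrite hN'; apply/asboolP.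
by apply/dim_le_submod => v; rewrite hN' => /asboolP.
Qed.

(** No dimension of a nonzero submodule lies strictly between consecutive entries of [ds], so an
    element of dimension less than entry [i] has dimension at most entry [i - 1], and is zero if
    [i = 0]. *)
Lemma dimension_filtrationP ds (D : nat -> submodClosed L) i :
  dimension_filtration ds D -> (i < size ds)%N ->
  (forall u, u \in D i.+1 <-> dimlt (nth 0%N ds i).+1 u) /\
  (forall u, u \in D i <-> dimlt (nth 0%N ds i) u).
Proof.
move=> [sds hds D0 hD _] ids.
have hD1 j : (j < size ds)%N -> forall u, u \in D j.+1 <-> dimlt (nth 0%N ds j).+1 u.
  by move=> jds; apply/largest_dim_leP; apply: hD.
split=> [|u]; first exact: hD1.
have lt_ds j k : (j < k < size ds)%N -> ((nth 0%N ds j) < (nth 0%N ds k))%N.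
  move=> /andP[jk kds]; apply: (sorted_ltn_nth ltn_trans) => //.
  exact: ltn_trans kds.
split.
  case: i ids => [|i] ids.
    by move=> /D0->; apply: submod0 (dimlt_submodule _).
  move=> /(hD1 i (ltnW ids)); apply: dimlt_le.
  by apply: lt_ds; rewrite ltnSn.
have [->|u0] := eqVneq u 0; first by rewrite rpred0.
move=> /dimlt_jump/(_ u0)[d [di ud nud]].
have dds : d \in ds by apply/hds/sub_dimP; exists u.
have jds : (index d ds < size ds)%N by rewrite index_mem.
have edj : nth 0%N ds (index d ds) = d by rewrite nth_index.
have ji : (index d ds < i)%N.
  rewrite ltnNge; apply/negP; rewrite leq_eqVlt => /orP[/eqP ij|ij].
    by rewrite ij edj ltnn in di.
  by have := lt_ds _ _ (introT andP (conj ij jds)); rewrite edj ltnNge ltnW.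
case: i ids di ji => // i ids di ji; apply/(hD1 i (ltnW ids)).
apply: dimlt_le ud; rewrite ltnS -edj.
move: ji; rewrite ltnS leq_eqVlt => /orP[/eqP->//|ji].
by apply: ltnW; apply: lt_ds; rewrite ji ltnW.
Qed.

Lemma exists_dimension_filtration :
  fin_dim L -> exists ds (D : nat -> submodClosed L), dimension_filtration ds D.
Proof.
case=> n0 hn0.
have /choice[F hF] n : exists N : submodClosed L, forall u, u \in N <-> dimlt n u.
  have [N hN] := submodule_closed (dimlt_submodule n).
  by exists N => u; rewrite hN asboolE.
have top u : dimlt n0.+1 u.
  by move=> k ch; apply: hn0; apply: chain_over_sub ch => a; apply.
pose ds := [seq d <- iota 0 n0.+1 | `[< sub_dim L d >]].
have dsP d : d \in ds <-> sub_dim L d.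
  rewrite mem_filter mem_iota add0n /=; split=> [/andP[/asboolP//]|hd].
  apply/andP; split; first exact/asboolP.
  have /sub_dimP[u ud nud] := hd.
  by apply: (top u); apply: dimlt_chain.
have sds : sorted ltn ds.
  exact: (sorted_filter ltn_trans _ (iota_ltn_sorted 0 n0.+1)).
(* [D i] will be [dimlt (e i)]; the successor turns the strict bound of [dimlt] into dimension at
   most entry [j], and the value 0 makes [D 0] zero. *)
pose e i := if i is j.+1 then (nth 0%N ds j).+1 else 0%N.
exists ds, (F \o e); split=> //=.
- by move=> x /hF/dimlt0.
- by move=> i _; apply/largest_dim_leP => u; apply: hF.
move=> x; have [->|x0] := eqVneq x 0; first exact: rpred0.
have [d [_ xd nxd]] := dimlt_jump (top x) x0.
have dds : d \in ds by apply/dsP/sub_dimP; exists x.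
have jds : (index d ds < size ds)%N by rewrite index_mem.
apply/hF; apply: dimlt_le xd; move: jds; rewrite /e.
case en: (size ds) => [//|n]; rewrite ltnS => jn.
rewrite ltnS -[X in (X <= _)%N](nth_index 0%N dds).
apply: (sorted_leq_nth leq_trans leqnn) => //; rewrite ?inE ?en //.
exact: (sub_sorted ltnW).
Qed.

End DimensionFiltration.

(** * Sequentially Cohen-Macaulay modules *)

Section RegularSeq.
Variables (S : comNzRingType) (L : lmodType S).
Implicit Types (A B : L -> Prop) (xs : seq S).

Lemma pregP A B xs :
  preg A B xs <->
  forall i, (i < size xs)%N -> reg_on A (modby A B (take i xs)) xs`_i.
Proof.
elim: xs B => [|x xs IH] B //=; rewrite IH; split=> [[rx rxs] [|i]|rxs] //.
  exact: rxs.
by split=> [|i]; [apply: (rxs 0%N)|apply: (rxs i.+1)].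
Qed.

Lemma modbyP A B xs u : A 0 -> modby A B xs u <->
  exists f : nat -> L, (forall i, A (f i)) /\
    B (u - \sum_(i < size xs) xs`_i *: f i).
Proof.
move=> A0; elim: xs B => [|x xs IH] B /=.
  split=> [Bu|[f [_]]]; last by rewrite big_ord0 subr0.
  by exists (fun=> 0); rewrite big_ord0 subr0.
rewrite IH; split=> [[f [Af [v Av Bv]]]|[f [Af]]].
  exists (fun i => if i is j.+1 then f j else v); split; first by case.
  by rewrite big_ord_recl /= opprD addrA addrAC.
rewrite big_ord_recl => Bf; exists (fun i => f i.+1); split=> [i|]; first exact: Af.
by exists (f 0%N) => //; rewrite -addrA -opprD [X in _ - X]addrC.
Qed.

Lemma regular_seqP xs :
  regular_seq L xs <->
  preg (fun _ : L => True) (fun u => u = 0) xs /\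
  exists u : L, ~ modby (fun _ => True) (fun u => u = 0) xs u.
Proof.
have in_smulP ys u : in_smul ys u <->
    modby (fun _ : L => True) (fun u => u = 0) ys u.
  rewrite modbyP //; split=> -[f]; first by move=> ->; exists f; rewrite subrr.
  by case=> _ /eqP; rewrite subr_eq0 => /eqP; exists f.
rewrite pregP /regular_seq; split=> -[rxs [u nu]].
  split; last by exists u => /in_smulP.
  by move=> i ixs v _ /in_smulP/(rxs i ixs)/in_smulP.
split; last by exists u => /in_smulP.
by move=> i ixs v /in_smulP/(rxs i ixs v I)/in_smulP.
Qed.

End RegularSeq.

(** * Annihilators and regular sequences of subquotients *)

Section Subquotients.
Variables (S : comNzRingType) (L : lmodType S) (A B : submodClosed L).
Local Notation memA := (fun u : L => u \in A).
Local Notation memB := (fun u : L => u \in B).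

Lemma subquot_proj : exists f : submod A -> subquot A B,
  [/\ forall q, exists u, f u = q, {morph f : u v / u - v},
      forall a u, f (a *: u) = a *: f u & forall u, f u = 0 <-> val u \in B].
Proof.
pose N := sub_in A B.
pose f (u : submod A) : subquot A B := (\pi_(Quotient.quot (submod_zmod N)) u)%qT.
have fB : {morph f : u v / u - v} by move=> u v; apply: raddfB.
exists f; split=> //.
- by move=> q; exists (repr q); apply: reprK.
- by move=> a u; rewrite /f -pi_scale.
move=> u; have -> : (val u \in B) = (u - 0 \in submod_zmod N) by rewrite subr0.
rewrite Quotient.idealrBE; have <- : f 0 = 0.
  by rewrite -(subrr (0 : submod A)) fB subrr.
by split=> [/eqP|/eqP].
Qed.

Lemma annihilates_subquot a :
  annihilates (subquot A B) a <-> annq memA memB a.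
Proof.
have [f [fsurj _ fZ f0]] := subquot_proj; split=> [h u uA|h q].
  by apply/(f0 (a *: (Sub u uA : submod A))); rewrite fZ h.
by have [u <-] := fsurj q; rewrite -fZ; apply/f0; apply: h; apply: valP.
Qed.

Lemma fin_gen_subquot : noeth_mod L -> fin_gen (subquot A B).
Proof.
move=> nL; have [s hs] := nL _ (closed_submodule A).
have [f [fsurj fB fZ f0]] := subquot_proj.
have f00 : f 0 = 0 by rewrite -(subrr (0 : submod A)) fB subrr.
apply/fin_genP; exists (pmap (fun u => omap f (insub u)) s) => q.
have [u <-] := fsurj q; have /hs := valP u.
have sA g : g \in s -> g \in A by move=> /span_mem/hs.
elim: s sA u {hs} => [|g s IH] sA u /=.
  by move=> u0; apply/f0; rewrite (u0 : val u = 0) rpred0.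
have gA := sA g (mem_head _ _); rewrite insubT /= => -[a ha].
exists a; rewrite -fZ -fB; apply: IH => [h hs|].
  by apply: sA; rewrite inE hs orbT.
exact: ha.
Qed.

Lemma regular_seq_subquot xs :
  regular_seq (subquot A B) xs <->
  preg memA memB xs /\ exists2 u, u \in A & ~ modby memA memB xs u.
Proof.
have [f [fsurj fB fZ f0]] := subquot_proj.
pose T (_ : subquot A B) := True.
(* Stated for any [C] that is the preimage of [D] on [A], so that the correspondence persists when
   both are enlarged by multiples of [x]. *)
have transfer (C : L -> Prop) (D : subquot A B -> Prop) :
    (forall u : submod A, C (val u) <-> D (f u)) ->
    (preg memA C xs <-> preg T D xs) /\
    forall u : submod A, modby memA C xs (val u) <-> modby T D xs (f u).
  elim: xs C D => [|x xs IH] C D CD //=.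
  have [|pIH mIH] := IH (addx memA C x) (addx T D x).
    move=> u; split=> [[v vA Cv]|[q _ Dq]].
      by exists (f (Sub v vA)) => //; rewrite -fZ -fB; apply/CD.
    have [v vq] := fsurj q; exists (val v); first exact: valP.
    by apply/(CD (u - x *: v)); rewrite fB fZ vq.
  split=> //; rewrite pIH; split=> -[rx pxs]; split=> //.
    move=> q _; have [u <-] := fsurj q; rewrite -fZ => /CD Cu.
    by apply/CD; apply: rx Cu; apply: valP.
  move=> u uA Cu; apply/(CD (Sub u uA)); apply: rx => //.
  by rewrite -fZ; apply/CD.
have [|pT mT] := transfer memB (fun q => q = 0).
  by move=> u; split=> /f0.
rewrite regular_seqP -pT; split=> -[pxs].
  move=> [q nq]; split=> //; have [u uq] := fsurj q.
  by exists (val u); [apply: valP|move/mT; rewrite uq].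
move=> [u uA nu]; split=> //; exists (f (Sub u uA)) => /mT; exact: nu.
Qed.

End Subquotients.

Section SeqCM.
Variables (S : comNzRingType) (m : {pred S}) (L : lmodType S).
Hypotheses (nS : noeth_mod S^o) (loc : local_with m) (nL : noeth_mod L).
Implicit Types (A B : L -> Prop).

Lemma preg_modby_proper A B xs :
  submodule A -> submodule B -> all (mem m) xs ->
  (forall u, A u -> modby A B xs u) -> forall u, A u -> B u.
Proof.
move=> sA; elim: xs B => [|x xs IH] B sB //= /andP[xm xsm] hm.
apply: (nakayama nS loc nL sA sB xm); apply: IH => //.
exact: addx_submodule.
Qed.

Lemma preg_trivial A B xs : submodule A -> (forall u, A u -> B u) -> preg A B xs.
Proof.
move=> sA; elim: xs B => [|x xs IH] B AB //=; split; first by move=> u /AB.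
by apply: IH => u /AB; apply: addx_sub.
Qed.

(* Also holds when the quotient is zero, on which every sequence is [preg]. *)
Definition full_depth d :=
  exists xs, [/\ all (mem m) xs, size xs = d &
    preg (@dimlt S L d.+1) (@dimlt S L d) xs].

Lemma dim_subquot d (A B : submodClosed L) :
  (forall u, u \in A <-> dimlt d.+1 u) -> (forall u, u \in B <-> dimlt d u) ->
  (exists2 u, u \in A & u \notin B) -> dim_eq (subquot A B) d.
Proof.
move=> hA hB [u uA uB]; have ud : dimlt d.+1 u by apply/hA.
have nud : ~ dimlt d u by move/hB; apply/negP.
have [p [up lt_p]] := dimlt_chain ud nud.
split; last first.
  have led : dim_le (submod A) d by apply/(dim_le_submod nL) => v /hA.
  move=> k ch; apply: led; apply: chain_over_sub ch => a /annihilates_submod ha.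
  by apply/annihilates_subquot => v /ha->; apply: rpred0.
apply: (chain_over_min (p := p)) => // a /annihilates_subquot ha.
(* If [a] kills the quotient but is outside [p ord0], the annihilator of [a *: u] is still inside
   [p ord0]; the chain then gives [a *: u] dimension at least [d], although it lies in [B]. *)
apply: contrapT => /negP ap; have /hB/(_ d) : a *: u \in B by apply: ha.
rewrite ltnn => ch; suff: false by []; apply: ch.
apply: (chain_over_min (p := p)) => // b; rewrite scalerA => /(up ord0).
by rewrite prime_idealrM (negPf ap) orbF.
Qed.

(** The dimension is [d] and [preg_chain] bounds regular sequences by it, so only a sequence of
    length [d] is at stake; its last quotient is nonzero by Nakayama's lemma. *)
Lemma cohen_macaulay_subquot d (A B : submodClosed L) :
  (forall u, u \in A <-> dimlt d.+1 u) -> (forall u, u \in B <-> dimlt d u) ->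
  (exists2 u, u \in A & u \notin B) ->
  cohen_macaulay (subquot A B) <-> full_depth d.
Proof.
move=> hA hB nAB; have [chd led] := dim_subquot hA hB nAB.
have eA : (fun u => is_true (u \in A)) = dimlt d.+1 by apply/predeqP.
have eB : (fun u => is_true (u \in B)) = dimlt d by apply/predeqP.
have sA := dimlt_submodule L d.+1; have sB := dimlt_submodule L d.
have sAB : exists2 u : L, dimlt d.+1 u & ~ dimlt d u.
  by case: nAB => u /hA uA uB; exists u => // /hB; apply/negP.
split=> [[m1 [n [loc1 _ [chn len] [[xs [sxs xsm hxs]] _]]]]|].
  move: hxs => /regular_seq_subquot; rewrite eA eB => -[pxs _]; exists xs; split=> //.
    by apply/allP => x /xsm; rewrite (loc.2 _ loc1.1).
  by rewrite sxs; apply/eqP; rewrite eqn_leq led // len.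
move=> [xs [xsm sxs pxs]]; exists m, d; split=> //.
  exact: fin_gen_subquot.
split.
  exists xs; split=> //; first by move=> x; apply/allP.
  apply/regular_seq_subquot; rewrite eA eB; split=> //.
  apply: contrapT => nmod; have [u uA nuB] := sAB; apply: nuB.
  apply: (preg_modby_proper sA sB xsm) uA => v vA.
  by apply: contrapT => nv; apply: nmod; exists v => //; rewrite eA.
move=> ys _ /regular_seq_subquot; rewrite eA eB => -[pys [u uA nu]].
apply: led; have : chain_over (annq (@dimlt S L d.+1) (dimlt d)) (size ys).
  by apply: preg_chain => //; exists u => //; apply/hA.
by apply: chain_over_sub => a /annihilates_subquot; rewrite eA eB.
Qed.

Lemma seqCM_moduleP :
  seqCM_module L <->
  [/\ exists x : L, x != 0, fin_dim L & forall d, full_depth d].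
Proof.
split=> [[nz _ fd [ds [D [filD cmD]]]]|[nz fd hd]].
  split=> // d.
  have [|nd] := EM (exists2 u : L, dimlt d.+1 u & ~ dimlt d u); last first.
    (* Where the filtration does not jump the quotient is zero, and a sequence of zeros serves. *)
    exists (nseq d 0); split; rewrite ?size_nseq //.
      by rewrite all_nseq; apply/orP; right; apply: submod0 (local_ideal loc).
    apply: preg_trivial => [|u ud]; first exact: dimlt_submodule.
    by apply: contrapT => nud; apply: nd; exists u.
  move=> hu; have dds : d \in ds.
    by case: filD => _ hds _ _ _; apply/hds/(sub_dimP nL).
  have ids : (index d ds < size ds)%N by rewrite index_mem.
  have [] := dimension_filtrationP nS nL filD ids.
  rewrite nth_index // => hA hB; apply/(cohen_macaulay_subquot hA hB); last exact: cmD.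
  by case: hu => u ud nud; exists u; [apply/hA|apply/negP => /hB].
have [ds [D filD]] := exists_dimension_filtration nS nL fd.
split=> //; first exact: noeth_mod_fin_gen.
exists ds, D; split=> // i ids.
have [hA hB] := dimension_filtrationP nS nL filD ids.
apply/(cohen_macaulay_subquot hA hB); last exact: hd.
have /(sub_dimP nL)[u ud nud] : sub_dim L (nth 0%N ds i).
  by case: filD => _ hds _ _ _; apply/hds; apply: mem_nth.
by exists u; [apply/hA|apply/negP => /hB].
Qed.

End SeqCM.

(** * Idealization *)

Section TrivialExtension.
Variables (R : comNzRingType) (M : lmodType R).
Local Notation A := (R ⋉ M).
Implicit Types (P Q : A -> Prop) (a b : R) (x y : M) (u v w : A).

Local Notation inc a := ((a, 0) : A).

Lemma trivext_mulE a b x y :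
  ((a, x) : A) * ((b, y) : A) = (a * b, a *: y + b *: x).
Proof. by []. Qed.

Lemma trivext_submodule P :
  submodule (S := A) (L := A^o) P -> submodule (S := R) (L := A) P.
Proof. by move=> [P0 hP]; split=> // a; apply: (hP (inc a)). Qed.

(** Since [(0, x)] squares to zero, it lies in every prime. *)
Lemma prime_trivextE (p : prime_idealr A) u : (u \in p) = (inc u.1 \in p).
Proof.
case: u => a x; have xp : ((0, x) : A) \in p.
  have : ((0, x) : A) * (0, x) \in p.
    by rewrite trivext_mulE mul0r !scale0r addr0 rpred0.
  by rewrite prime_idealrM orbb.
have {1}-> : ((a, x) : A) = inc a + (0, x) by congr pair; rewrite /= ?addr0 ?add0r.
by rewrite rpredDr.
Qed.

(** Contraction along [inc] and preimage under the first projection match the primes of both rings.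
    The square suffices because primes are radical, and it is what [dimlt_trivext] supplies. *)
Lemma chain_trivext (I : A -> Prop) (J : R -> Prop) n :
  (forall u, I u -> J (u.1 * u.1)) -> (forall a, J a -> I (inc a)) ->
  chain_over I n <-> chain_over J n.
Proof.
move=> IJ JI; split=> -[p [hp lt_p]].
  have /choice[q hq] i : exists q : prime_idealr R, forall a, a \in q <-> inc a \in p i.
    apply: prime_idealP.
    - split=> [|c a b ap bp]; first exact: rpred0.
      have -> : inc (c *: (a : R^o) + b) = inc c * inc a + inc b.
        by congr pair; rewrite /= !scaler0 !addr0.
      by apply: rpredD => //; apply: idealMr.
    - by rewrite -[inc 1]/(1 : A) idealr1.
    - move=> a b; have -> : inc (a * b) = inc a * inc b.
        by congr pair; rewrite /= !scaler0 addr0.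
      by rewrite prime_idealrM => /orP.
  exists q; split=> [i a /JI/hp Ia|i j /lt_p[sij nji]]; first exact/hq.
  split=> [a /hq/sij/hq//|sji]; apply: nji => u.
  by rewrite prime_trivextE => /hq/sji/hq; rewrite -prime_trivextE.
have /choice[q hq] i : exists q : prime_idealr A, forall u, u \in q <-> u.1 \in p i.
  apply: prime_idealP.
  - split=> [|c u v up vp]; first exact: rpred0.
    by apply: rpredD => //; apply: idealMr.
  - by rewrite idealr1.
  - by move=> u v; rewrite prime_idealrM => /orP.
exists q; split=> [i u /IJ/(hp i)|i j /lt_p[sij nji]].
  by rewrite prime_idealrM orbb => /hq.
split=> [u /hq/sij/hq//|sji]; apply: nji => a ap.
by have /sji/hq : inc a \in q j by apply/hq.
Qed.

Lemma dimlt_trivext n u : dimlt (L := A^o) n u <-> dimlt (S := R) (L := A) n u.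
Proof.
have ch k : chain_over (fun v : A => v *: (u : A^o) = 0) k <->
    chain_over (fun a : R => a *: (u : A) = 0) k.
  apply: chain_trivext => // -[a x] h.
  (* [(a, - x) * (a, x) = (a * a, 0)], so if [(a, x)] kills [u], then so does [a * a]. *)
  have -> : (a * a) *: u = ((a, - x) : A) * (((a, x) : A) * u).
    by rewrite mulrA trivext_mulE scalerN subrr.
  by rewrite [_ * u]h mulr0.
by split=> h k /ch/h.
Qed.

Lemma dimlt_prod n u :
  dimlt (S := R) n u <-> dimlt (L := R^o) n u.1 /\ dimlt n u.2.
Proof.
have zeroE a : a *: u = 0 <-> a *: (u.1 : R^o) = 0 /\ a *: u.2 = 0.
  rewrite [a *: u]trivext_scaleE; split=> [[h1 h2]|[h1 h2]]; first by split.
  by congr pair.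
split=> [h|[h1 h2] k ch].
  by split=> k ch; apply: h; apply: chain_over_sub ch => a /zeroE[].
have [|/h1//|/h2//] := chain_overI (ann_ideal (u.1 : R^o)) (ann_ideal u.2) (n := k).
by apply: chain_over_sub ch => a /zeroE.
Qed.

Lemma addx_prod (A1 B1 : R^o -> Prop) (A2 B2 : M -> Prop) a :
  addx (S := R) (L := A) (fun u => A1 u.1 /\ A2 u.2) (fun u => B1 u.1 /\ B2 u.2) a =
  (fun u => addx A1 B1 a u.1 /\ addx A2 B2 a u.2).
Proof.
apply/predeqP => u; split=> [[v [v1 v2]]|[[b b1 b2] [x x1 x2]]].
  by rewrite [a *: v]trivext_scaleE => -[b1 b2]; split; [exists v.1|exists v.2].
by exists (b, x); rewrite // [a *: _]trivext_scaleE.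
Qed.

Lemma preg_prod (A1 B1 : R^o -> Prop) (A2 B2 : M -> Prop) xs :
  submodule A1 -> submodule B1 -> submodule A2 -> submodule B2 ->
  preg (S := R) (L := A) (fun u => A1 u.1 /\ A2 u.2) (fun u => B1 u.1 /\ B2 u.2) xs
  <-> preg A1 B1 xs /\ preg A2 B2 xs.
Proof.
move=> sA1 + sA2; elim: xs B1 B2 => [|a xs IH] B1 B2 sB1 sB2 /=; first by [].
rewrite addx_prod IH; [|exact: addx_submodule|exact: addx_submodule].
split=> [[ra [p1 p2]]|[[r1 p1] [r2 p2]]]; last first.
  split=> // u [u1 u2]; rewrite [a *: u]trivext_scaleE => -[b1 b2].
  by split; [apply: r1|apply: r2].
split; split=> //.
  move=> b Ab Bb; have [|//|//] := ra (b, 0).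
    by split=> //; exact: (submod0 sA2).
  by rewrite [a *: _]trivext_scaleE /= scaler0; split=> //; exact: (submod0 sB2).
move=> x Ax Bx; have [|//|//] := ra (0, x).
  by split=> //; exact: (submod0 sA1).
by rewrite [a *: _]trivext_scaleE /= mulr0; split=> //; exact: (submod0 sB1).
Qed.

(** Scaling by [a] over [R] is by definition multiplication by [inc a]. *)
Lemma preg_inc P Q xs :
  preg (S := R) (L := A) P Q xs = preg (L := A^o) P Q [seq inc a | a <- xs].
Proof. by elim: xs Q => //= a xs IH Q; rewrite -IH. Qed.

(* (a, x)^2 = (a, 2x) (a, 0) *)
Lemma reg_inc P Q v :
  submodule (L := A^o) P -> submodule (L := A^o) Q ->
  reg_on (L := A^o) P Q v -> reg_on (L := A^o) P Q (inc v.1).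
Proof.
have vv : v * v = (v + (0, v.2)) * inc v.1.
  by case: v => a x; rewrite !trivext_mulE /= scaler0 add0r addr0 scalerDr.
move=> sP sQ rv u Pu Qu; apply: (rv) => //; apply: rv.
  exact: (submodZ _ sP).
rewrite scalerA vv -scalerA; exact: (submodZ _ sQ).
Qed.

Section Local.
Variable m : {pred R}.
Hypotheses (nR : noeth_mod R^o) (loc : local_with m) (fgM : fin_gen M).

Definition trivext_max : {pred A} := [pred u : A | u.1 \in m].

Lemma trivext_local : local_with trivext_max.
Proof.
have sm := local_ideal loc; have m1 := local_proper loc.
have maxA : maximal_ideal trivext_max.
  split; first split.
  - exact: (submod0 sm).
  - exact: m1.
  - by move=> a u v um vm; apply: sm.2.
  move=> J [J0 J1 JD] mJ u; apply/idP/idP => [uJ|]; last exact: mJ.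
  apply: contrapT => /negP /(local_unit nR loc)[b bu].
  (* With [b] inverse to [u.1], [inc b * u] is 1 up to an element of [0 x M], which [J] contains. *)
  case/negP: J1; have -> : (1 : A) = inc b * u + (0, - (b *: u.2)).
    by congr pair; rewrite /= ?bu ?addr0 // scaler0 addr0 subrr.
  by apply: JD => //; apply: mJ; apply: (submod0 sm).
split=> // J [[J0 J1 JD] maxJ] u; apply/esym; move: u; apply: maxJ => [|u uJ].
  by case: maxA.
apply: contrapT => /negP /(local_unit nR loc)[b bu].
(* This is the inverse of [u]; the added 0 fits the closure condition of ideals. *)
case/negP: J1; have -> : (1 : A) = ((b, - (b * b) *: u.2) : A) * u + 0.
  rewrite addr0; congr pair; rewrite /= ?bu // scalerA mulrN mulrA [u.1 * b]mulrC bu.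
  by rewrite mul1r scaleNr subrr.
exact: JD.
Qed.

Lemma trivext_noeth_mod : noeth_mod (A : lmodType R).
Proof.
apply: fin_gen_noeth_mod => //; apply/fin_genP.
have /fin_genP[s hs] := fgM.
exists (inc 1 :: [seq (0, g) : A | g <- s]) => u; exists u.1.
have -> : u - u.1 *: (inc 1 : A) = (0, u.2).
  rewrite [_ *: _]trivext_scaleE /= scaler0 mulr1.
  by congr pair; rewrite /= ?subrr ?subr0.
move: u.2 (hs u.2); elim: s {hs} => [|g s IH] x /= => [->//|[c /IH xc]].
exists c; have -> : (0, x) - c *: ((0, g) : A) = (0, x - c *: g) => //.
by rewrite [_ *: _]trivext_scaleE /= mulr0; congr pair; rewrite /= subr0.
Qed.

(** Every ideal is an [R]-submodule, and its generators over [R] also generate it over [A]. *)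
Lemma trivext_noeth_ring : noeth_mod A^o.
Proof.
move=> P sP; have [s hs] := trivext_noeth_mod (trivext_submodule sP).
exists s => u; split=> [/hs us|us].
  apply: (span_min (trivext_submodule (span_submodule (L := A^o) s))) us.
  by move=> g gs; apply: span_mem.
by apply: (span_min sP) us => g gs; apply/hs; apply: span_mem.
Qed.

(** [us] accumulates the elements of [R] already rotated to the front, while [vs] loses its last
    term at each step. *)
Lemma preg_trivext P Q vs us :
  submodule (L := A^o) P -> submodule (L := A^o) Q ->
  all (mem m) us -> all (mem trivext_max) vs ->
  preg (L := A^o) P Q ([seq inc a | a <- us] ++ vs) ->
  exists xs, [/\ all (mem m) xs, size xs = (size us + size vs)%N &
    preg (S := R) (L := A) P Q xs].
Proof.
move=> sP sQ; elim/last_ind: vs us => [|vs v IH] us usm.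
  by rewrite cats0 -preg_inc; exists us; rewrite addn0.
rewrite all_rcons => /andP[vm vsm]; rewrite -rcons_cat => /preg_rcons[pv rv].
have sQ' := modby_submodule ([seq inc a | a <- us] ++ vs) sP sQ.
have pv' := (iffRL (preg_rcons _ _ _ _)) (conj pv (reg_inc sP sQ' rv)).
have usm' : all (mem m) (v.1 :: us) by apply/andP.
have [|xs [xsm sxs pxs]] := IH (v.1 :: us) usm' vsm.
  apply: (preg_rotate trivext_noeth_ring trivext_local trivext_noeth_ring) => //.
  by rewrite all_cat vsm andbT all_map.
by exists xs; rewrite sxs /= size_rcons addnS.
Qed.

Lemma full_depth_trivext d :
  full_depth trivext_max A^o d <-> full_depth m (A : lmodType R) d.
Proof.
have eqF n : @dimlt _ A^o n = @dimlt R A n.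
  by apply/predeqP => u; apply: dimlt_trivext.
have sF n : submodule (L := A^o) (@dimlt _ A^o n) by apply: dimlt_submodule.
rewrite /full_depth -!eqF; split=> -[xs [xsm sxs pxs]].
  have [|||ys [ysm sys pys]] := @preg_trivext _ _ xs [::] (sF d.+1) (sF d).
  - by [].
  - exact: xsm.
  - exact: pxs.
  by exists ys; rewrite sys.
exists [seq inc a | a <- xs]; rewrite size_map -preg_inc; split=> //.
by rewrite all_map.
Qed.

Lemma full_depth_prod d :
  full_depth m (A : lmodType R) d <-> full_depth m R^o d /\ full_depth m M d.
Proof.
have eqF n : @dimlt R A n = (fun u => dimlt (L := R^o) n u.1 /\ dimlt n u.2).
  by apply/predeqP => u; apply: dimlt_prod.
have sR := dimlt_submodule R^o; have sM := dimlt_submodule M.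
rewrite /full_depth !eqF; split=> [[xs [xsm sxs]]|].
  by move/preg_prod => -[] // p1 p2; split; exists xs.
move=> [[xs [xsm sxs p1]] [ys [ysm sys p2]]].
have [|zs [zsm szs q1 q2]] := common_preg nR loc nR
  (fin_gen_noeth_mod nR fgM) (sR _) (sR _) (sM _) (sM _) xsm ysm _ p1 p2.
  by rewrite sxs sys.
by exists zs; split=> //; [rewrite szs|apply/preg_prod].
Qed.

End Local.

Lemma fin_dim_trivext : fin_dim A^o <-> fin_dim (A : lmodType R).
Proof.
have ch k : has_chain A^o k <-> has_chain (A : lmodType R) k.
  apply: chain_trivext => [u h v|a h v]; last exact: h.
  have -> : u = 0 by have := h 1; rewrite [_ *: _]mulr1.
  by rewrite mul0r scale0r.
by split=> -[n hn]; exists n => k /ch/hn.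
Qed.

Lemma fin_dim_ring (L : lmodType R) : fin_dim R^o -> fin_dim L.
Proof.
case=> n hn; exists n => k ch; apply: hn; apply: chain_over_sub ch => a ha x.
by rewrite -[a]mulr1 [a * 1](ha 1) scale0r.
Qed.

Lemma fin_dim_base : fin_dim (A : lmodType R) -> fin_dim R^o.
Proof.
case=> n hn; exists n => k ch; apply: hn; apply: chain_over_sub ch => a ha b.
by have /(congr1 fst) := ha (inc b); rewrite [_ *: _]trivext_scaleE.
Qed.

End TrivialExtension.

Theorem theorem1p2 (R : comNzRingType) (M : lmodType R)
    (noethR : noetherian R) (localR : local_ring R)
    (fgM : fin_gen M) (nzM : exists x : M, x != 0%R) :
  (seqCM_local_ring (R ⋉ M) <-> seqCM_module (R ⋉ M)) /\
  (seqCM_module (R ⋉ M) <-> (seqCM_local_ring R /\ seqCM_module M)).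
Proof.
have nR := noetherianP noethR; have [m loc] := localR.
have nM := fin_gen_noeth_mod nR fgM.
have nRA := trivext_noeth_mod nR fgM; have nA := trivext_noeth_ring nR fgM.
have locA := trivext_local M nR loc.
(* All four modules are nonzero, so only finite dimension and full depth in every degree remain to
   be compared. *)
have seqA := seqCM_moduleP nA locA nA.
have seqRA := seqCM_moduleP nR loc nRA.
have seqR := seqCM_moduleP nR loc nR.
have seqM := seqCM_moduleP nR loc nM.
have nzA : exists u : R ⋉ M, u != 0 by exists 1; apply: oner_neq0.
have nzR : exists a : R^o, a != 0 by exists 1; apply: oner_neq0.
split; split.
- move=> [_ [_ _ /seqA[_ fd hd]]]; apply/seqRA; split=> //.
    exact/fin_dim_trivext.
  by move=> d; apply/full_depth_trivext.
- move=> /seqRA[_ /fin_dim_trivext fd hd].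
  split; first by exists (trivext_max m).
  split=> //; first exact: noeth_mod_noetherian.
  by apply/seqA; split=> // d; apply/full_depth_trivext.
- move=> /seqRA[_ /fin_dim_base fd hd].
  have hd' d := (iffLR (full_depth_prod nR loc fgM d)) (hd d).
  split; last by apply/seqM; split=> [||d] //; [exact: fin_dim_ring|case: (hd' d)].
  by split=> //; split=> //; apply/seqR; split=> // d; case: (hd' d).
move=> [[_ [_ fd /seqR[_ _ hR]]] /seqM[_ _ hM]].
apply/seqRA; split=> //; first exact: fin_dim_ring.
by move=> d; apply/full_depth_prod.
Qed.
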